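(* In each of the following posets under the consecutive order, a finitely based avoidance set (that is, a set $\mathrm{Av}(B)$ with $B$ finite) is well quasi-ordered if and only if it is finite: (1) the poset $\mathcal{G}$ of graphs; (2) the poset $\mathcal{S}$ of simple graphs; (3) the poset $\mathcal{D}$ of digraphs; (4) the poset $\mathcal{T}$ of tournaments; (5) the poset $\mathcal{R}_\sigma$ of relational structures with signature $\sigma$.
   Context: All structures are finite and carry a distinguished linear order: the underlying set is taken to be $[1,n]=\{1,\dots,n\}$ for some $n\in\mathbb{N}=\{1,2,\dots\}$ with its natural order (any finite subset of $\mathbb{N}$ may be used as underlying set, and two structures of the same kind are isomorphic, $\cong$, and then considered equal, if relabelling their points in increasing order by $1,2,\dots$ gives the same structure). The length $|\tau|$ of a structure $\tau$ is its number of points, and $\tau\upharpoonright_Y$ is its restriction to the points in $Y$. Besides the linear order: a graph has one symmetric binary relation; a simple graph has one symmetric irreflexive binary relation; a digraph has one binary relation; a tournament has one irreflexive binary relation containing exactly one of $(u,v),(v,u)$ for all distinct points $u,v$. The signature of a relational structure is the sequence of arities of its relations; a relational structure with signature $\sigma$ consists of a finite set with a sequence of relations whose arities form $\sigma$, the first relation being the distinguished linear order, with no further conditions. Consecutive order: $\tau\leq\rho$ iff $\tau\cong\rho\upharpoonright_{[k,k+|\tau|-1]}$ for some $k\ge1$ with $k+|\tau|-1\le|\rho|$. For a subset $B$ of a poset $(X,\leq)$, $\mathrm{Av}(B)=\{x\in X: \beta\nleq x\text{ for all }\beta\in B\}$. A poset is well quasi-ordered if it contains neither infinite antichains nor infinite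 descending sequences.
   Formalization: In (5) the signature must contain, besides the distinguished linear order, a relation of arity at least 2; otherwise the claim fails, e.g. for σ = (2) and B empty, where Av(B) is the infinite chain of all finite linear orders. *)

(* Defs.v *)
From HB Require Import structures.
From mathcomp Require Import all_boot all_order.
From mathcomp Require Import boolp classical_sets functions cardinality.

Set Implicit Arguments.
Unset Strict Implicit.
Unset Printing Implicit Defensive.

Import Order.TTheory.
Local Open Scope order_scope.
Local Open Scope classical_set_scope.

(* Every finite linearly ordered set has a unique increasing relabelling by an
   initial segment, so isomorphism classes are represented by the structures on
   'I_n.+1 (nonempty, points counted from 0). The distinguished linear order is
   the natural order of 'I_n.+1 and is not stored: s lists the arities of the
   other relations, i.e., relstr s has signature 2 :: s. *)
Definition relstr (s : seq nat) : Type :=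
  {n : nat & {dffun forall i : 'I_(size s),
                {ffun (nth 0%N s i).-tuple 'I_n.+1 -> bool}}}.

HB.instance Definition _ s := Choice.on (relstr s).

Section RelStr.
Variable s : seq nat.
Implicit Types t r : relstr s.

Definition len t : nat := (tag t).+1.

Definition holds t (i : 'I_(size s)) :
  {ffun (nth 0%N s i).-tuple 'I_(len t) -> bool} := tagged t i.

(* Restriction of t to its points k, ..., k + m, relabelled by 0, ..., m;
   meaningful when k + m < len t, as inord (k + j) is then the point k + j. *)
Definition window t (k m : nat) : relstr s :=
  existT _ m (finfun (fun i : 'I_(size s) =>
    [ffun x : (nth 0%N s i).-tuple 'I_m.+1 =>
       holds t i (map_tuple (fun j : 'I_m.+1 => inord (k + j) : 'I_(len t)) x)])).

Definition consecutive_le r t : bool :=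
  [exists k : 'I_(len t),
     (k + len r <= len t)%N && (r == window t k (len r).-1)].

Lemma window_full t : window t 0 (len t).-1 = t.
Proof.
case: t => n f; rewrite /window /=; congr existT.
apply/ffunP => i; rewrite ffunE; apply/ffunP => x; rewrite ffunE.
rewrite /holds /=; congr (f i _); apply: val_inj => /=.
by rewrite -[RHS]map_id; apply: eq_map => j; rewrite add0n inord_val.
Qed.

Lemma window_window t k m k' m' : (k + m < len t)%N -> (k' + m' <= m)%N ->
  window (window t k m) k' m' = window t (k + k') m'.
Proof.
move=> km km'; rewrite {1 3}/window; congr existT.
apply/ffunP => i; rewrite !ffunE; apply/ffunP => x; rewrite !ffunE.
rewrite /holds /= ffunE ffunE /holds; congr (tagged t i _).
apply: val_inj => /=; rewrite -map_comp; apply: eq_map => j /=.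
congr inord; rewrite inordK ?addnA // ltnS (leq_trans _ km') // leq_add2l.
by rewrite -ltnS.
Qed.

Lemma consecutive_leP r t :
  reflect (exists2 k, (k + len r <= len t)%N & r = window t k (len r).-1)
          (consecutive_le r t).
Proof.
apply: (iffP existsP) => [[k /andP[kr /eqP rE]]|[k kr rE]]; first by exists k.
have kt : (k < len t)%N by rewrite (leq_trans _ kr) // /len addnS ltnS leq_addr.
by exists (Ordinal kt); rewrite kr /= -rE.
Qed.

Lemma consecutive_le_refl : reflexive consecutive_le.
Proof. by move=> t; apply/consecutive_leP; exists 0%N; rewrite ?window_full. Qed.

Lemma consecutive_le_anti : antisymmetric consecutive_le.
Proof.
move=> r t /andP[/consecutive_leP[k kr rE] /consecutive_leP[k' kt _]].
have lrt : len r = len t.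
  by apply/eqP; rewrite eqn_leq (leq_trans _ kr) ?(leq_trans _ kt) // leq_addl.
have k0 : k = 0%N.
  by apply/eqP; move: kr; rewrite lrt -{2}[len t]add0n leq_add2r leqn0.
by rewrite rE lrt k0 window_full.
Qed.

Lemma consecutive_le_trans : transitive consecutive_le.
Proof.
move=> t r u /consecutive_leP[k kr rE] /consecutive_leP[k' kt tE].
apply/consecutive_leP; exists (k' + k)%N.
  by rewrite -addnA (leq_trans _ kt) // leq_add2l.
rewrite {1}rE {1}tE window_window //.
  by move: kt; rewrite /len addnS.
by move: kr; rewrite /len addnS.
Qed.

End RelStr.

Fact consecutive_display : Order.disp_t.
Proof. exact: Order.Disp tt tt. Qed.

HB.instance Definition _ s :=
  Order.Le_isPOrder.Build consecutive_display (relstr s)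
    (@consecutive_le_refl s) (@consecutive_le_anti s) (@consecutive_le_trans s).

Definition digraph : Type := relstr [:: 2].

HB.instance Definition _ := Order.POrder.on digraph.

Definition adj (g : digraph) (u v : 'I_(len g)) : bool :=
  @holds [:: 2] g ord0 [tuple u; v].

Record graph : Type := Graph {
  graph_val :> digraph;
  _ : [forall u, forall v, adj (g := graph_val) u v == adj v u] }.

HB.instance Definition _ := [isSub for graph_val].
HB.instance Definition _ := [Choice of graph by <:].
HB.instance Definition _ :=
  [SubChoice_isSubPOrder of graph by <: with consecutive_display].

Record simple_graph : Type := SimpleGraph {
  simple_graph_val :> digraph;
  _ : [forall u, forall v, adj (g := simple_graph_val) u v == adj v u]
      && [forall u, ~~ adj (g := simple_graph_val) u u] }.

HB.instance Definition _ := [isSub for simple_graph_val].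
HB.instance Definition _ := [Choice of simple_graph by <:].
HB.instance Definition _ :=
  [SubChoice_isSubPOrder of simple_graph by <: with consecutive_display].

Record tournament : Type := Tournament {
  tournament_val :> digraph;
  _ : [forall u, ~~ adj (g := tournament_val) u u]
      && [forall u, forall v,
            (u != v) ==> (adj (g := tournament_val) u v (+) adj v u)] }.

HB.instance Definition _ := [isSub for tournament_val].
HB.instance Definition _ := [Choice of tournament by <:].
HB.instance Definition _ :=
  [SubChoice_isSubPOrder of tournament by <: with consecutive_display].

Section WellQuasiOrder.
Context {d : Order.disp_t} {X : porderType d}.
Implicit Types A B C : set X.

Definition Av B : set X := [set x | forall b, B b -> ~~ (b <= x)].

Definition antichain A : Prop :=
  forall x y, A x -> A y -> x != y -> x >< y.

(* C with the order induced from X. *)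
Definition well_quasi_ordered C : Prop :=
  (~ exists A : set X, [/\ A `<=` C, infinite_set A & antichain A]) /\
  (~ exists f : nat -> X, (forall n, C (f n)) /\ forall n, f n.+1 < f n).

End WellQuasiOrder.

(* Main.v *)
Require Import Defs.
From mathcomp Require Import all_boot all_order.
From mathcomp Require Import boolp classical_sets functions cardinality.
From mathcomp Require Import zify.

Set Implicit Arguments.
Unset Strict Implicit.
Unset Printing Implicit Defensive.

Import Order.TTheory.
Local Open Scope classical_set_scope.

(** A finite set is always well quasi-ordered. For the converse, let L bound the
lengths of the structures in the finite set B. Whether x avoids B depends only
on the windows of x with at most L points, and such a window contains no two
points at distance exactly L. So the relations between points at distance L can
be rewritten at will without leaving Av B ([Av_mark]).

This freedom is used to mark the ends: a relation of arity at least 2 is made to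
hold from u to u + L exactly when u is the first point or u + L the last one;
such a pair is called joined. If a marked r embeds as a
window of a marked t, then both joined pairs of r must land on joined pairs of
t; there are only two of these, so the window starts at the first point of t and
stops at its last one, and r and t have the same length ([mark_le_len]). Two
marked structures are therefore incomparable as soon as they differ.

If Av B is infinite, then it has structures of unbounded length, as there are
finitely many of each length; marking them gives an infinite antichain
([well_quasi_ordered_Av]). Marking can be done inside each of the classes
considered, so the argument is carried out for any poset that embeds in
structures of a fixed signature and is closed under marking. *)

Section Marking.
Variable s : seq nat.
Implicit Types (t r : relstr s) (i : 'I_(size s)).

Definition at_end L t u : bool := (u == 0) || (u + L.+1 == len t).

(** Each relation of arity at least 2 is rewritten on the tuples whose first two
entries are at distance L. The descending pairs get the same value as the
ascending ones when c is false, which preserves symmetry, and the opposite value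
when c is true, which preserves being a tournament; both need 0 < L. *)
Definition mark (c : bool) L t : relstr s :=
  existT _ (tag t) (finfun (fun i : 'I_(size s) =>
    [ffun x : (nth 0 s i).-tuple 'I_(len t) =>
       if map val x is [:: u, v & _] then
         if v == u + L then at_end L t u
         else if u == v + L then c (+) at_end L t v
         else holds t i x
       else holds t i x])).

Lemma window_mark c L t k m : m < L -> k + m < len t ->
  window (mark c L t) k m = window t k m.
Proof.
move=> mL kmt; congr existT.
apply/ffunP => i; rewrite !ffunE; apply/ffunP => x; rewrite !ffunE.
rewrite /holds /= !ffunE /=.
have -> : [seq val j | j <- [seq inord (k + val j) : 'I_(len t) | j <- x]]
    = [seq k + val j | j <- x].
  rewrite -map_comp; apply: eq_map => j /=.
  by rewrite inordK //; have := ltn_ord j; rewrite /len in kmt *; lia.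
case: (tval x) => [|a [|b l]] //=.
have am := ltn_ord a; have bm := ltn_ord b.
by rewrite !ifF //; apply/eqP; lia.
Qed.

(** The binary trace (u, v, v, ..., v) of a relation: it turns an equality of
structures into equalities of booleans indexed by pairs of points. *)
Definition rel2 t i u v : bool :=
  holds t i [tuple (if val j == 0 then inord u else inord v) | j < nth 0 s i].

Lemma rel2_window t k m i u v : k + m < len t -> u <= m -> v <= m ->
  rel2 (window t k m) i u v = rel2 t i (k + u) (k + v).
Proof.
move=> kmt um vm; rewrite /rel2 /window /holds /= !ffunE.
congr (tagged t i _); apply: eq_from_tnth => j.
by rewrite tnth_map !tnth_mktuple; case: ifP => _; rewrite inordK.
Qed.

Lemma rel2_mark c L t i u : 1 < nth 0 s i -> u + L < len t ->
  rel2 (mark c L t) i u (u + L) = at_end L t u.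
Proof.
move=> i2 uLt; rewrite /rel2 /holds /= !ffunE.
set x := mktuple _.
suff [l ->] : exists l, map val x = [:: u, u + L & l] by rewrite eqxx.
have ut : u < len t by lia.
rewrite {}/x; case: (nth 0 s i) i2 => [|[|n]] // _.
rewrite /= enum_ordSl /= enum_ordSl /= !inordK //.
by eexists.
Qed.

(** The joined pairs of r start at 0 and at len r - L.+1, which are distinct as
L.+1 < len r. If r occurs in t at offset k, then k and k + (len r - L.+1) both
start joined pairs of t, hence are 0 and len t - L.+1. *)
Lemma mark_le_len c L r t i : 1 < nth 0 s i -> L.+1 < len r ->
  (mark c L r <= mark c L t)%O -> len r = len t.
Proof.
move=> i2 Lr /consecutive_leP[k]; rewrite /len /= -/(len r) -/(len t) => krt rE.
have endE u : u + L < len r -> at_end L r u = at_end L t (k + u).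
  move=> uLr; rewrite -(rel2_mark c i2) // rE rel2_window;
    try by rewrite /len /= in krt uLr *; lia.
  by rewrite addnA rel2_mark //; lia.
have := endE 0; have := endE (len r - L.+1).
by rewrite /at_end; lia.
Qed.

Lemma relstr_le_len r t : (r <= t)%O -> len r = len t -> r = t.
Proof.
move=> /consecutive_leP[k krt rE] rt; have k0 : k = 0 by lia.
by rewrite rE rt k0 window_full.
Qed.

Lemma finite_len_le N : finite_set [set t : relstr s | len t <= N].
Proof.
apply: (@sub_finite_set _ _
  (\bigcup_(n in `I_N) range (fun f => existT _ n f : relstr s))).
  by move=> [n f] /= nN; exists n => //; exists f.
by apply: bigcup_finite => // n _; apply: finite_image; apply: finite_finset.
Qed.

End Marking.

Lemma finite_well_quasi_ordered d (X : porderType d) (C : set X) :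
  finite_set C -> well_quasi_ordered C.
Proof.
move=> Cfin; split=> [[A [AC Ainf _]]|[f [Cf fS]]].
  exact/Ainf/(sub_finite_set AC).
have f_inj : injective f.
  by apply: dec_inj; apply: Order.NatMonotonyTheory.decnP.
apply: infinite_nat; apply: (@sub_finite_set _ _ (f @^-1` C)).
  by move=> n _; apply: Cf.
by apply: finite_preimage => // m n _ _; apply: f_inj.
Qed.

(** The map v stands for the inclusion of a class of structures, such as graphs
or tournaments, that is closed under marking. *)
Section Embedded.
Context {d : Order.disp_t} {X : porderType d} {s : seq nat}.
Variables (v : X -> relstr s) (c : bool).
Hypothesis v_le : forall x y, (x <= y)%O = (v x <= v y)%O.
Hypothesis v_mark : forall L x, 0 < L -> exists y, v y = mark c L (v x).
Hypothesis s2 : has (fun k => 2 <= k) s.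

Lemma embedded_unbounded (C : set X) N : infinite_set C ->
  exists2 x, C x & N < len (v x).
Proof.
move=> Cinf; apply: contrapT => noC; apply: Cinf.
have v_inj : injective v.
  by move=> x y vxy; apply/le_anti; rewrite !v_le vxy lexx.
apply: (@sub_finite_set _ _ (v @^-1` [set t | len t <= N])).
  by move=> x Cx /=; rewrite leqNgt; apply/negP => xN; apply: noC; exists x.
apply: finite_preimage; last exact: finite_len_le.
by move=> x y _ _; apply: v_inj.
Qed.

Lemma unbounded_infinite (C : set X) :
  (forall N, exists2 x, C x & N < len (v x)) -> infinite_set C.
Proof.
move=> Cub /finite_seqP[e eE].
have [x] := Cub (\max_(y <- e) len (v y)); rewrite eE /= => xe.
by rewrite ltnNge (@leq_bigmax_seq _ _ predT (fun y => len (v y))).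
Qed.

(** An occurrence of b in the marked structure is a window of at most L points,
which is also a window of the original one. *)
Lemma Av_mark (B : set X) L x y : (forall b, B b -> len (v b) <= L) ->
  v y = mark c L (v x) -> Av B x -> Av B y.
Proof.
move=> BL vy Avx b Bb; apply/negP; rewrite v_le vy.
move=> /consecutive_leP[k]; rewrite {2}/len /= -/(len (v x)) => kb bE.
have bL := BL _ Bb.
suff : (b <= x)%O by apply/negP/Avx.
rewrite v_le; apply/consecutive_leP; exists k => //.
by rewrite {1}bE window_mark //; rewrite /len in kb bL *; lia.
Qed.

Lemma well_quasi_ordered_Av (B : set X) : finite_set B ->
  well_quasi_ordered (Av B) <-> finite_set (Av B).
Proof.
move=> /finite_seqP[e eE]; split; last exact: finite_well_quasi_ordered.
move=> [noA _]; apply: contrapT => Avinf; apply: noA.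
(* Marking needs 0 < L, also when B is empty. *)
pose L := (\max_(b <- e) len (v b)).+1.
have BL b : B b -> len (v b) <= L.
  rewrite eE /= => be; apply/leqW.
  exact: (@leq_bigmax_seq _ _ predT (fun y => len (v y))).
have [i i2] : exists i : 'I_(size s), 1 < nth 0 s i.
  by have /(has_nthP 0)[j js] := s2; exists (Ordinal js).
(* The strict bound L.+1 < len (v y) makes the first and last pairs distinct. *)
exists [set y | [/\ Av B y, L.+1 < len (v y) &
                 exists x, v y = mark c L (v x)]]; split.
- by move=> y [].
- apply: unbounded_infinite => N.
  have [x Avx xN] := embedded_unbounded (maxn N L.+1) Avinf.
  have [y vy] := @v_mark L x isT.
  have yx : len (v y) = len (v x) by rewrite vy.
  exists y; last by lia.
  by split; [exact: Av_mark BL vy Avx | lia | exists x].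
- have len_eq y z : L.+1 < len (v y) -> (exists x, v y = mark c L (v x)) ->
      (exists x, v z = mark c L (v x)) -> (y <= z)%O -> y = z.
    move=> Ly [r yr] [t zt] yz; apply/le_anti; rewrite yz v_le /=.
    rewrite v_le in yz.
    suff -> : v y = v z by exact: lexx.
    apply: relstr_le_len => //.
    move: yz Ly; rewrite yr zt => yz Ly.
    exact: (@mark_le_len _ c L (v r) (v t) i i2 Ly yz).
  move=> y z [_ Ly yM] [_ Lz zM]; apply: contra => /orP[yz|zy].
    by apply/eqP/len_eq.
  by apply/eqP/esym/len_eq.
Qed.

End Embedded.

Lemma adj_mark c L (g : digraph) (u v : 'I_(len g)) :
  adj (g := mark c L g) u v =
    if v == u + L :> nat then at_end L g u
    else if u == v + L :> nat then c (+) at_end L g v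
    else adj u v.
Proof. by rewrite /adj /holds /= !ffunE. Qed.

Lemma mark_graph L (g : graph) : 0 < L ->
  exists h : graph, graph_val h = mark false L (graph_val g).
Proof.
move=> L0; suff gP : [forall u, forall v,
    adj (g := mark false L (graph_val g)) u v == adj v u] by exists (Graph gP).
apply/forallP => u; apply/forallP => v; rewrite !adj_mark.
have /forallP/(_ u)/forallP/(_ v)/eqP -> := valP g.
by case: ((v : nat) =P u + L) => vE; case: ((u : nat) =P v + L) => uE //; lia.
Qed.

Lemma mark_simple_graph L (g : simple_graph) : 0 < L ->
  exists h : simple_graph,
    simple_graph_val h = mark false L (simple_graph_val g).
Proof.
move=> L0; have /andP[sym irr] := valP g.
pose h := mark false L (simple_graph_val g).
suff hP : [forall u, forall v, adj (g := h) u v == adj v u]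
    && [forall u, ~~ adj (g := h) u u] by exists (SimpleGraph hP).
apply/andP; split; apply/forallP => u; last first.
  by rewrite adj_mark !ifF ?(forallP irr) //; apply/eqP; lia.
apply/forallP => v; rewrite !adj_mark.
have /forallP/(_ u)/forallP/(_ v)/eqP -> := sym.
by case: ((v : nat) =P u + L) => vE; case: ((u : nat) =P v + L) => uE //; lia.
Qed.

Lemma mark_tournament L (g : tournament) : 0 < L ->
  exists h : tournament, tournament_val h = mark true L (tournament_val g).
Proof.
move=> L0; have /andP[irr tour] := valP g.
pose h := mark true L (tournament_val g).
suff hP : [forall u, ~~ adj (g := h) u u]
    && [forall u, forall v, (u != v) ==> (adj (g := h) u v (+) adj v u)].
  by exists (Tournament hP).
apply/andP; split; apply/forallP => u.
  by rewrite adj_mark !ifF ?(forallP irr) //; apply/eqP; lia.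
apply/forallP => v; apply/implyP => uv; rewrite !adj_mark.
have /forallP/(_ u)/forallP/(_ v)/implyP/(_ uv) := tour.
by case: ((v : nat) =P u + L) => vE; case: ((u : nat) =P v + L) => uE //=;
  rewrite ?addbN ?addNb ?addbb //; lia.
Qed.

(* In the last part the signature is 2 :: s. If every arity in s is at most 1,
   structures are words over a finite alphabet; the words in a single letter
   then form a finitely based, infinite, well quasi-ordered avoidance set. *)
Theorem corollary7p5 :
  (forall B : set graph, finite_set B ->
     (well_quasi_ordered (Av B) <-> finite_set (Av B))) /\
  (forall B : set simple_graph, finite_set B ->
     (well_quasi_ordered (Av B) <-> finite_set (Av B))) /\
  (forall B : set digraph, finite_set B ->
     (well_quasi_ordered (Av B) <-> finite_set (Av B))) /\
  (forall B : set tournament, finite_set B ->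
     (well_quasi_ordered (Av B) <-> finite_set (Av B))) /\
  (forall s : seq nat, has (fun k => 2 <= k)%N s ->
     forall B : set (relstr s), finite_set B ->
     (well_quasi_ordered (Av B) <-> finite_set (Av B))).
Proof.
split=> [B|]; first exact: (well_quasi_ordered_Av _ mark_graph).
split=> [B|]; first exact: (well_quasi_ordered_Av _ mark_simple_graph).
split=> [B|].
  apply: (@well_quasi_ordered_Av _ _ [:: 2] id false) => // L x _.
  by exists (mark false L x).
split=> [B|s s2 B]; first exact: (well_quasi_ordered_Av _ mark_tournament).
apply: (@well_quasi_ordered_Av _ _ s id false) => // L x _.
by exists (mark false L x).
Qed.
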